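(* Let $a,b,c\in\mathbb{R}\setminus\{0\}$ with $b^2-4ac>0$. Let $\{P_m(z)\}_{m\geq 0}$ be the sequence of functions of $z$ generated by \[ \sum_{m=0}^\infty P_m(z)\, t^m=\frac{1}{(at^2+bt+c)(1-tz)}. \] Then $\lim \mathcal{Z}(P_m)$ exists and \[ \lim \mathcal{Z}(P_m)=\left\{z\in\mathbb{C}: |z|=\frac{1}{|\alpha|}\right\}, \] where $\alpha$ is the zero of $at^2+bt+c$ of smallest modulus.
   Context: A sequence $\{P_m(z)\}$ is generated by $f(t,z)$ if, for each $z\in\mathbb{C}$, $f(t,z)$ is analytic in $t$ in a neighborhood of $t=0$ and $P_m(z)$ is the coefficient of $t^m$ in the power series expansion of $f(t,z)$ in $t$ about $0$. For a sequence of functions $f_m$ analytic on a region $D$ (here $D=\mathbb{C}$), $\mathcal{Z}(f_m)$ denotes the set of zeros of $f_m$ in $D$. $\liminf\mathcal{Z}(f_m)$ is the set of $z^*\in D$ such that for every $r>0$ there is $N$ with $B(r,z^* )\cap\mathcal{Z}(f_m)\neq\emptyset$ for all $m>N$; $\limsup\mathcal{Z}(f_m)$ is the set of $z^*\in D$ such that for every $r>0$ and every $N$ there is $m>N$ with $B(r,z^* )\cap\mathcal{Z}(f_m)\neq\emptyset$. When these coincide, $\lim\mathcal{Z}(f_m)$ denotes the common set. Here $B(r,z^* )$ is the open disk of radius $r$ centered at $z^*$. *)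

(* Defs.v *)
From mathcomp Require Import all_boot all_order all_algebra.
From mathcomp Require Import complex.
From mathcomp Require Import reals.
Set Implicit Arguments. Unset Strict Implicit. Unset Printing Implicit Defensive.
Import Order.TTheory GRing.Theory Num.Theory.
Local Open Scope ring_scope.
Local Open Scope complex_scope.

Section Defs.
Variable R : realType.

(* Taylor coefficients about t = 0 of 1/(a t^2 + b t + c) (c <> 0):
   the unique sequence d with (a t^2 + b t + c) * sum_k d_k t^k = 1, i.e.
   c d_0 = 1, c d_1 + b d_0 = 0, c d_k + b d_{k-1} + a d_{k-2} = 0 (k >= 2). *)
Fixpoint recip_coef (a b c : R) (n : nat) : R :=
  match n with
  | 0 => c^-1
  | 1 => - b * c^-1 * c^-1
  | S ((S n'') as n') =>
      - (b * recip_coef a b c n' + a * recip_coef a b c n'') / c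
  end.

(* P_m(z) = coefficient of t^m in 1/((a t^2 + b t + c)(1 - t z))
          = sum_{k=0}^m d_{m-k} z^k  (Cauchy product with sum_k z^k t^k). *)
Definition Pgen (a b c : R) (m : nat) (z : R[i]) : R[i] :=
  \sum_(k < m.+1) (recip_coef a b c (m - k))%:C * z ^+ k.

Definition liminf_zeros (f : nat -> R[i] -> R[i]) (z : R[i]) : Prop :=
  forall r : R, 0 < r -> exists N : nat, forall m : nat, (N < m)%N ->
    exists w : R[i], f m w = 0 /\ `|w - z| < r%:C.

Definition limsup_zeros (f : nat -> R[i] -> R[i]) (z : R[i]) : Prop :=
  forall r : R, 0 < r -> forall N : nat, exists m : nat, (N < m)%N /\
    exists w : R[i], f m w = 0 /\ `|w - z| < r%:C.

End Defs.

(* Main.v *)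
Require Import Defs.
From mathcomp Require Import all_boot all_order all_algebra.
From mathcomp Require Import complex.
From mathcomp Require Import reals.
From mathcomp Require Import ring lra.
Import Order.TTheory GRing.Theory Num.Theory.
Local Open Scope ring_scope.
Local Open Scope complex_scope.

(** Let u = 1/alpha and v = 1/beta, where beta is the other root; since alpha
    and beta are real, distinct and not opposite, x = v/u satisfies |x| < 1.
    Up to a nonzero factor P_m(u w) is S_m(w) = sum_k (1 - x^(m-k+1)) w^k, and
      (1 - w)(x - w) S_m(w) = (1 - x) w^(m+2) - (1 - x^(m+2)) w + x - x^(m+2).
    As m grows, (1 - w) S_m(w) tends to 1 uniformly on |w| <= q < 1, and the
    term w^(m+2) dominates on |w| >= q > 1, so zeros only accumulate on |w| = 1.

    Conversely, if a polynomial p of degree n has no zero within r of z, then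
    (p'^2 - p p'')/p^2, which is the sum of (z - w_j)^-2 over the zeros w_j, is
    at most n/r^2 in modulus at z.  For the right-hand side above and a point
    z <> 1 of the unit circle, p'^2 - p p'' grows like m^2 while p is bounded,
    so every disk around z contains a zero once m is large. *)

(** * Locating a zero of a polynomial from its first two derivatives *)

(** Cleared of denominators, the sum over the zeros allows induction on the list of roots: for p =
    (X - w) q one has p'^2 - p p'' = q^2 + (z - w)^2 (q'^2 - q q''), so each root adds at most
    |p(z)|^2. *)
Lemma prod_XsubC_log_deriv2_bound (F : numDomainType) (s : seq F) (z r : F) :
  0 <= r -> {in s, forall w, r <= `|z - w|} ->
  let p := \prod_(w <- s) ('X - w%:P) in
  r ^+ 2 * `|p^`().[z] ^+ 2 - p.[z] * p^`()^`().[z]|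
    <= (size s)%:R * `|p.[z]| ^+ 2.
Proof.
move=> r0; elim: s => [|w s IHs] sr /=.
  by rewrite big_nil -polyC1 derivC deriv0 !hornerE expr0n /= subr0 normr0 mulr0.
have wr : r <= `|z - w| by apply: sr; rewrite mem_head.
have /IHs {IHs} : {in s, forall v, r <= `|z - v|}.
  by move=> v vs; apply: sr; rewrite in_cons vs orbT.
rewrite big_cons; set q := \prod_(v <- s) _ => /= IHs.
rewrite derivM derivXsubC mul1r derivD derivM derivXsubC mul1r.
rewrite !(hornerD, hornerM, hornerN, hornerX, hornerC).
rewrite [X in `|X|](_ : _ = q.[z] ^+ 2 +
    (z - w) ^+ 2 * (q^`().[z] ^+ 2 - q.[z] * q^`()^`().[z])); last by ring.
have H1 : `|q.[z] ^+ 2 + (z - w) ^+ 2 * (q^`().[z] ^+ 2 - q.[z] * q^`()^`().[z])|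
   <= `|q.[z]| ^+ 2 + `|z - w| ^+ 2 * `|q^`().[z] ^+ 2 - q.[z] * q^`()^`().[z]|.
  by apply: le_trans (ler_normD _ _) _; rewrite normrX normrM normrX.
apply: le_trans (ler_wpM2l _ H1) _; first exact: exprn_ge0.
rewrite normrM exprMn mulrDr -natr1 mulrDl mul1r [leRHS]addrC.
apply: lerD; first by rewrite ler_wpM2r ?exprn_ge0 // lerXn2r ?nnegrE.
by rewrite mulrCA [leRHS]mulrCA ler_wpM2l ?exprn_ge0.
Qed.

(** Contrapositive of the previous bound. The leading coefficient is harmless, because both sides
    scale by the square of its modulus. *)
Lemma root_near (F : numClosedFieldType) (p : {poly F}) (z r : F) :
  p != 0 -> 0 < r ->
  (size p).-1%:R * `|p.[z]| ^+ 2
    < r ^+ 2 * `|p^`().[z] ^+ 2 - p.[z] * p^`()^`().[z]| ->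
  exists2 w, root p w & `|w - z| < r.
Proof.
move=> p0 r0; have [s defp] := closed_field_poly_normal p.
have : lead_coef p != 0 by rewrite lead_coef_eq0.
move: (lead_coef p) defp => a defp a0.
set q := \prod_(w <- s) ('X - w%:P) in defp.
have szs : (size p).-1 = size s by rewrite defp size_scale // size_prod_XsubC.
have rootq w : w \in s -> root p w by rewrite defp rootZ // root_prod_XsubC.
have [/hasP[w ws wz]|/hasPn far] := boolP (has (fun w => `|w - z| < r) s).
  by exists w => //; apply: rootq.
have /(prod_XsubC_log_deriv2_bound _ _ _ _ (ltW r0)) /= :
    {in s, forall w, r <= `|z - w|}.
  by move=> w /far; rewrite -real_leNgt ?normr_real ?gtr0_real // distrC.
rewrite -/q => /(ler_wpM2l (exprn_ge0 2 (normr_ge0 a))).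
rewrite szs defp !derivZ !hornerZ [in ltRHS](_ : _ - _ =
  a ^+ 2 * (q^`().[z] ^+ 2 - q.[z] * q^`()^`().[z])); last by ring.
rewrite 2!normrM normrX exprMn => le_p; rewrite mulrCA [ltRHS]mulrCA => lt_p.
by move: (lt_le_trans lt_p le_p); rewrite ltxx.
Qed.

(** * The sums [hsum]: closed forms and estimates at fixed m *)

(** (1 - x) times the complete homogeneous symmetric polynomial of degree m
    in 1, x, w. *)
Definition hsum {K : comPzRingType} (x : K) (m : nat) (w : K) : K :=
  \sum_(k < m.+1) (1 - x ^+ (m - k).+1) * w ^+ k.

Lemma hsum_mul1B (K : comPzRingType) (x : K) m w :
  (1 - w) * hsum x m w =
  1 - w ^+ m.+1 - (1 - w) * x * \sum_(k < m.+1) x ^+ (m - k) * w ^+ k.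
Proof.
rewrite /hsum (eq_bigr (fun k : 'I__ => w ^+ k - x * (x ^+ (m - k) * w ^+ k))).
  by rewrite sumrB -mulr_sumr mulrBr mulrA -[in X in _ = X - _](expr1n _ m.+1)
    subrXX; congr (_ * _ - _); apply: eq_bigr => k _; rewrite expr1n mul1r.
by move=> k _; rewrite exprS; ring.
Qed.

(** The factor [x - w] telescopes the sum left over in [hsum_mul1B]. The price of this sparse form
    is the two extra zeros 1 and [x]. *)
Lemma hsum_mul1BBE (K : comPzRingType) (x : K) m w :
  (1 - w) * (x - w) * hsum x m w =
  (1 - x) * w ^+ m.+2 - (1 - x ^+ m.+2) * w + (x - x ^+ m.+2).
Proof.
have E : (x - w) * \sum_(k < m.+1) x ^+ (m - k) * w ^+ k = x ^+ m.+1 - w ^+ m.+1.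
  by rewrite subrXX; congr (_ * _); apply: eq_bigr => k _; rewrite subSS.
rewrite mulrAC hsum_mul1B mulrBl -!mulrA [X in x * X]mulrC E.
by rewrite ![_ ^+ m.+2]exprSr; ring.
Qed.

(** At a zero, [hsum_mul1B] writes 1 as [w ^+ m.+1] plus [(1 - w) * x] times a sum of m + 1 terms of
    modulus at most [q ^+ m]. The 3 is 1 for the first summand plus 2 for the factor
    [(1 - w) * x]. *)
Lemma hsum_eq0_inner (F : numFieldType) (x w q : F) m :
  `|x| <= q -> `|w| <= q -> q < 1 -> hsum x m w = 0 -> 1 <= m.+1%:R * q ^+ m * 3.
Proof.
move=> xq wq q1 S0.
have q0 : 0 <= q by apply: le_trans xq.
have:= hsum_mul1B _ x m w; rewrite S0 mulr0 => /esym/eqP.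
rewrite subr_eq0 subr_eq addrC => /eqP E.
have le1 := ler_normD (w ^+ m.+1)
  ((1 - w) * x * \sum_(k < m.+1) x ^+ (m - k) * w ^+ k).
rewrite -E normr1 in le1; apply: le_trans le1 _.
have Hs : `|\sum_(k < m.+1) x ^+ (m - k) * w ^+ k| <= m.+1%:R * q ^+ m.
  apply: le_trans (ler_norm_sum _ _ _) _.
  apply: (@le_trans _ _ (\sum_(k < m.+1) q ^+ m)); last first.
    by rewrite sumr_const card_ord mulr_natl.
  apply: ler_sum => k _; rewrite normrM !normrX.
  have -> : q ^+ m = q ^+ (m - k) * q ^+ k by rewrite -exprD subnK // -ltnS.
  by apply: ler_pM; rewrite ?exprn_ge0 //; apply: lerXn2r; rewrite ?nnegrE.
have x1 : `|x| <= 1 by apply: le_trans xq (ltW q1).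
have w1 : `|w| <= 1 by apply: le_trans wq (ltW q1).
have H1 : `|(1 - w) * x| <= 2.
  rewrite normrM -[2]mulr1; apply: ler_pM => //.
  by apply: le_trans (ler_normB _ _) _; rewrite normr1 -[2]/(1 + 1) lerD2l.
have Hw : `|w ^+ m.+1| <= m.+1%:R * q ^+ m.
  rewrite normrX exprS; apply: ler_pM => //; rewrite ?exprn_ge0 //.
    by apply: le_trans w1 _; rewrite ler1n.
  by apply: lerXn2r; rewrite ?nnegrE.
rewrite [leRHS](_ : _ = 2 * (m.+1%:R * q ^+ m) + m.+1%:R * q ^+ m); last by ring.
by rewrite addrC normrM; apply: lerD => //; apply: ler_pM.
Qed.

(** At a zero, the top term of [hsum_mul1BBE] equals the two lower ones, whose moduli add up to at
    most 2|w| + 2 <= 4|w|; a factor |w| is then cancelled. *)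
Lemma hsum_eq0_outer (F : numFieldType) (x w q : F) m :
  `|x| < 1 -> 1 <= q -> q <= `|w| -> hsum x m w = 0 ->
  (1 - `|x|) * q ^+ m.+1 <= 4.
Proof.
move=> x1 q1 qw S0.
have := hsum_mul1BBE _ x m w; rewrite S0 mulr0 => H0.
have E : (1 - x) * w ^+ m.+2 = (1 - x ^+ m.+2) * w - (x - x ^+ m.+2).
  by apply/eqP; rewrite -subr_eq0 [X in _ == X]H0; apply/eqP; ring.
have w1 : 1 <= `|w| by apply: le_trans q1 qw.
have w0 : 0 < `|w| by apply: lt_le_trans w1.
have xM1 : `|x ^+ m.+2| <= 1 by rewrite normrX exprn_ile1 // ltW.
have d1 : 1 - `|x| <= `|1 - x| by rewrite -[X in X - _]normr1 lerB_dist.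
have H : `|1 - x| * `|w| ^+ m.+2 <= 4 * `|w|.
  rewrite -normrX -normrM E; apply: le_trans (ler_normB _ _) _.
  rewrite normrM (_ : 4 * `|w| = 2 * `|w| + 2 * `|w|); last by ring.
  apply: lerD.
    rewrite ler_wpM2r //; apply: le_trans (ler_normB _ _) _.
    by rewrite normr1 -[2]/(1 + 1) lerD2l.
  apply: le_trans (ler_normB _ _) _.
  apply: (@le_trans _ _ 2); last by rewrite ler_peMr.
  by rewrite -[2]/(1 + 1) lerD // ltW.
rewrite -(ler_pM2r w0); apply: le_trans H.
rewrite [in leRHS]exprSr mulrA ler_wpM2r //.
apply: ler_pM => //; first by rewrite subr_ge0 ltW.
  by rewrite exprn_ge0 // (le_trans ler01).
by rewrite lerXn2r ?nnegrE // (le_trans ler01).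
Qed.

(** [root_near] is applied to the right-hand side of [hsum_mul1BBE]. The two upper bounds on [r]
    keep the extra zeros 1 and [x] out of the disk, and the last two hypotheses make the quadratic
    term in m win. *)
Lemma hsum_root_near (F : numClosedFieldType) (x w r : F) m :
  `|x| < 1 -> `|w| = 1 -> 0 < r -> r <= `|1 - w| -> r <= 1 - `|x| ->
  4 * `|x| ^+ m.+2 <= 1 - `|x| ->
  36 + 16 * r ^+ 2 < m.+1%:R * (r ^+ 2 * ((1 - `|x|) ^+ 2 / 2)) ->
  exists2 w', hsum x m w' = 0 & `|w' - w| < r.
Proof.
move=> x1 w1 r0 rw rx xM mlarge.
set d := 1 - `|x| in rx xM mlarge.
have d0 : 0 < d by rewrite subr_gt0.
pose A := 1 - x; pose B := 1 - x ^+ m.+2; pose G := x - x ^+ m.+2.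
pose W := w ^+ m; pose n : F := m%:R.
pose p : {poly F} := A *: 'X^(m.+2) - B *: 'X + G%:P.
have pE y : p.[y] = (1 - y) * (x - y) * hsum x m y.
  by rewrite hsum_mul1BBE
    !(hornerD, hornerN, hornerZ, hornerXn, hornerX, hornerC).
have xM1 : `|x ^+ m.+2| <= 1 by rewrite normrX exprn_ile1 // ltW.
have W1 : `|W| = 1 by rewrite normrX w1 expr1n.
have dA : d <= `|A| by rewrite /d -[X in X - _](normr1 F) lerB_dist.
have le2 (y : F) : `|y| <= 1 -> `|1 - y| <= 2.
  move=> y1; apply: le_trans (ler_normB _ _) _.
  by rewrite normr1 -[2]/(1 + 1) lerD2l.
have A2 : `|A| <= 2 by rewrite le2 // ltW.
have B2 : `|B| <= 2 by rewrite le2.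
have G2 : `|G| <= 2.
  by apply: le_trans (ler_normB _ _) _; rewrite -[2]/(1 + 1) lerD // ltW.
have n0 : 0 <= n by rewrite ler0n.
have mE : m.+1%:R = n + 1 :> F by rewrite -natr1.
have nE : m.+2%:R = n + 2 :> F by rewrite -addn2 natrD.
have p0 : p.[w] = A * (W * w ^+ 2) - B * w + G.
  rewrite /p !(hornerD, hornerN, hornerZ, hornerXn, hornerX, hornerC).
  by rewrite -exprD addn2.
have p1 : p^`().[w] = A * ((n + 2) * (W * w)) - B.
  rewrite /p derivD derivB !derivZ derivXn derivX derivC addr0.
  rewrite !(hornerMn, hornerD, hornerN, hornerZ, hornerXn, hornerX, hornerC).
  by rewrite -exprSr mulr1 -[_ *+ m.+2]mulr_natl nE.
have p2 : p^`()^`().[w] = A * ((n + 2) * ((n + 1) * W)).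
  rewrite /p derivD derivB !derivZ derivXn derivX derivC addr0.
  rewrite derivB !derivZ derivMn derivXn -polyC1 derivC scaler0 subr0.
  rewrite !(hornerMn, hornerZ, hornerXn).
  by rewrite -[_ *+ m.+2]mulr_natl -[_ *+ m.+1]mulr_natl mE nE.
have pn0 : p != 0.
  apply/eqP => /(congr1 (fun q : {poly F} => q`_m.+2)).
  rewrite coef0 !(coefD, coefN, coefZ, coefXn, coefX, coefC) /= eqxx mulr1 mulr0.
  rewrite subr0 addr0 => A0.
  by move: (lt_le_trans d0 dA); rewrite A0 normr0 ltxx.
have szp : (size p).-1%:R <= n + 2.
  have szp : (size p <= m.+3)%N.
    have szZ (c : F) k : (k < m.+3)%N -> (size (c *: 'X^k) <= m.+3)%N.
      by move=> km; rewrite (leq_trans (size_scale_leq _ _)) // size_polyXn.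
    rewrite (leq_trans (size_polyD _ _)) // geq_max.
    rewrite (leq_trans (size_polyC_leq1 _)) // andbT.
    rewrite (leq_trans (size_polyD _ _)) // geq_max size_polyN.
    by rewrite szZ // -['X]expr1 szZ.
  by rewrite -nE ler_nat; case: (size p) szp.
(* The term w - x has modulus at least [d], and the perturbation at most 2|x|^(m+2) <= d/2. *)
have BG : d / 2 <= `|B * w - G|.
  have -> : B * w - G = (w - x) - x ^+ m.+2 * (w - 1) by rewrite /B /G; ring.
  apply: le_trans (lerB_dist _ _); rewrite normrM normrX.
  have H1 : d <= `|w - x| by apply: le_trans (lerB_dist _ _); rewrite w1.
  have H2 : `|x| ^+ m.+2 * `|w - 1| <= `|x| ^+ m.+2 * 2.
    by rewrite ler_wpM2l ?exprn_ge0 // distrC le2 ?w1.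
  apply: le_trans (lerB H1 H2); rewrite -subr_ge0.
  rewrite (_ : _ - _ = (d - 4 * `|x| ^+ m.+2) / 2); last by field.
  by rewrite divr_ge0 ?subr_ge0.
(* The n^2 parts of the terms in A^2 cancel, so the quadratic growth comes only from
   [A * W * (B * w - G)]. *)
have D0 : p^`().[w] ^+ 2 - p.[w] * p^`()^`().[w] =
  (n + 2) * ((n + 1) * (A * W * (B * w - G)))
  + ((n + 2) * (A * (W * w)) ^+ 2 - (n + 2) * (2 * A * B * (W * w)) + B ^+ 2).
  by rewrite p0 p1 p2; ring.
have Ww1 : `|W * w| = 1 by rewrite normrM W1 w1 mulr1.
have sq4 (y : F) : `|y| <= 2 -> `|y| ^+ 2 <= 4.
  move=> y2; rewrite (_ : 4 = 2 ^+ 2); last by ring.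
  by rewrite lerXn2r ?nnegrE.
have n20 : 0 <= n + 2 by rewrite addr_ge0.
have n10 : 0 <= n + 1 by rewrite addr_ge0.
have E16 : `|(n + 2) * (A * (W * w)) ^+ 2 - (n + 2) * (2 * A * B * (W * w)) + B ^+ 2|
  <= (n + 2) * 16.
  rewrite (_ : _ * 16 = (n + 2) * 4 + (n + 2) * 8 + (n + 2) * 4); last by ring.
  apply: le_trans (ler_normD _ _) _; apply: lerD.
    apply: le_trans (ler_normB _ _) _; rewrite 2!(normrM (n + 2)) ger0_norm //.
    apply: lerD; rewrite ler_wpM2l //.
      by rewrite normrX normrM Ww1 mulr1 sq4.
    rewrite normrM Ww1 mulr1 -mulrA normrM ger0_norm //.
    rewrite (_ : 8 = 2 * (2 * 2)); last by ring.
    by rewrite ler_wpM2l // normrM ler_pM.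
  rewrite normrX; apply: le_trans (sq4 _ B2) _.
  by rewrite ler_peMl // (le_trans _ (lerD n0 (lexx _))) // add0r ler1n.
have [] := root_near _ p w r pn0 r0.
  rewrite D0.
  (* Here 36 is the square of |p(w)| <= 2 + 2 + 2, and the degree is at most n + 2. *)
  apply: le_lt_trans (_ : (n + 2) * 36 < _).
    apply: ler_pM; rewrite ?exprn_ge0 ?ler0n // p0.
    rewrite (_ : 36 = 6 ^+ 2); last by ring.
    rewrite lerXn2r ?nnegrE //.
    apply: le_trans (ler_normD _ _) _.
    rewrite (_ : 6 = 2 + 2 + 2); last by ring.
    apply: lerD G2.
    apply: le_trans (ler_normB _ _) _; apply: lerD.
      by rewrite !normrM W1 w1 !mulr1.
    by rewrite normrM w1 mulr1.
  have r20 : 0 <= r ^+ 2 by rewrite exprn_ge0 // ltW.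
  have low : (n + 2) * ((n + 1) * (d * (d / 2))) - (n + 2) * 16 <=
   `|(n + 2) * ((n + 1) * (A * W * (B * w - G)))
  + ((n + 2) * (A * (W * w)) ^+ 2 - (n + 2) * (2 * A * B * (W * w)) + B ^+ 2)|.
    rewrite -[X in `|_ + X|]opprK; apply: le_trans (lerB_dist _ _).
    rewrite normrN; apply: lerB => //.
    rewrite normrM (ger0_norm n20) ler_wpM2l // normrM (ger0_norm n10) ler_wpM2l //.
    by rewrite normrM (normrM A) W1 mulr1 ler_pM // ?divr_ge0 // ltW.
  apply: lt_le_trans (ler_wpM2l r20 low).
  rewrite -subr_gt0.
  rewrite (_ : _ - _ = (n + 2) *
     ((n + 1) * (r ^+ 2 * (d ^+ 2 / 2)) - (36 + 16 * r ^+ 2))); last by field.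
  by rewrite mulr_gt0 ?subr_gt0 -?mE // ltr_wpDl.
move=> y /rootP; rewrite pE => /eqP.
rewrite !mulf_eq0 -orbA => /or3P[/eqP y1|/eqP yx|/eqP] yw.
- move: (lt_le_trans yw rw).
  by rewrite (_ : y = 1) ?ltxx //; apply/esym/subr0_eq.
- have : `|w| - `|x| <= `|w - x| by apply: lerB_dist.
  rewrite w1 -/d => /(le_trans rx)/(lt_le_trans yw).
  by rewrite (_ : y = x) ?[`|x - w|]distrC ?ltxx //; apply/esym/subr0_eq.
- by exists y.
Qed.

(** * Decay of n q^n, over the reals and then over R[i] *)

(** This is the quadratic term of the binomial expansion; the linear one would not give n q^n ->
    0. *)
Lemma bernoulli2 (R : realFieldType) (h : R) n :
  0 <= h -> n%:R * (n%:R - 1) * h ^+ 2 <= 2 * (1 + h) ^+ n.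
Proof.
move=> h0.
(* The linear bound is carried along because the left side of the quadratic one grows by 2 n h^2 at
   each step, which is at most 2 h (1 + h)^n. *)
suff [] : n%:R * (n%:R - 1) * h ^+ 2 <= 2 * (1 + h) ^+ n /\
    n%:R * h <= (1 + h) ^+ n by [].
elim: n => [|n [IH2 IH1]]; first by rewrite expr0; split; lra.
have y1 : 1 <= (1 + h) ^+ n by rewrite exprn_ege1 // lerDl.
have k0 : 0 <= n%:R :> R by [].
rewrite [(1 + h) ^+ _]exprS -natr1.
move: n%:R ((1 + h) ^+ n) k0 y1 IH1 IH2 => k y k0 y1 IH1 IH2.
have hy := ler_wpM2l h0 IH1; have h1 := ler_wpM2l h0 y1.
by split; lra.
Qed.

(** With 1 + h = 1/q, [bernoulli2] gives n (n - 1) h^2 q^n <= 2, so n - 1 > 2 / (h^2 e) suffices. *)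
Lemma natr_mul_expr_small (R : archiRealFieldType) (q e : R) :
  0 <= q < 1 -> 0 < e ->
  exists N, forall n, (N < n)%N -> n%:R * q ^+ n < e.
Proof.
move=> /andP[q0 q1] e0; case: (eqVneq q 0) => [->|qn0].
  by exists 0 => n n0; rewrite expr0n gtn_eqF // mulr0.
have {qn0} qp : 0 < q by rewrite lt_neqAle eq_sym qn0.
pose h := q^-1 - 1.
have h0 : 0 < h by rewrite subr_gt0 invf_gt1.
have he : 0 < h ^+ 2 * e by rewrite mulr_gt0 ?exprn_gt0.
exists (Num.bound (2 / (h ^+ 2 * e))).+1 => n Nn.
have : 2 / (h ^+ 2 * e) < n%:R - 1.
  apply: lt_le_trans (archi_boundP _) _; first by rewrite divr_ge0 // ltW.
  by rewrite lerBrDr natr1 ler_nat ltnW.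
rewrite ltr_pdivrMr // => big; rewrite ltNge; apply/negP => le_e.
have := bernoulli2 R h n (ltW h0).
rewrite [1 + h]addrC subrK exprVn ler_pdivlMr ?exprn_gt0 // => le2.
suff /(lt_le_trans big) : (n%:R - 1) * (h ^+ 2 * e)
    <= n%:R * (n%:R - 1) * h ^+ 2 * q ^+ n.
  by move=> /lt_le_trans/(_ le2); rewrite ltxx.
rewrite (_ : _ * q ^+ n = (n%:R - 1) * (h ^+ 2 * (n%:R * q ^+ n))); last by ring.
have n1 : 0 <= n%:R - 1 :> R by rewrite subr_ge0 ler1n (leq_trans _ Nn).
by rewrite !ler_wpM2l // ?exprn_ge0 // ltW.
Qed.

(** Moduli of complex numbers have type [R[i]], so the real estimate is transported along the
    embedding of [R]. *)
Lemma complex_natr_mul_expr_small (R : realType) (q e : R[i]) :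
  0 <= q < 1 -> 0 < e ->
  exists N, forall n, (N < n)%N -> n%:R * q ^+ n < e.
Proof.
move=> /andP[q0 q1] e0.
have [s qE] := complex_realP q (ger0_real q0).
have [d eE] := complex_realP e (gtr0_real e0).
move: q0 q1 e0; rewrite qE eE ler0c -(rmorph1 (real_complex R)).
rewrite -(rmorph0 (real_complex R)) !ltcR => s0 s1 d0.
have [|N Nn] := natr_mul_expr_small R s d _ d0; first by rewrite s0.
by exists N => n /Nn; rewrite -ltcR rmorphM rmorphXn rmorph_nat.
Qed.

Lemma complex_natr_large (R : realType) (y : R[i]) :
  0 <= y -> exists N, forall n, (N < n)%N -> y < n%:R.
Proof.
move=> y0; have [s yE] := complex_realP y (ger0_real y0).
move: y0; rewrite yE ler0c => s0; exists (Num.bound s) => n Nn.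
rewrite -(rmorph_nat (real_complex R)) ltcR (lt_trans (archi_boundP s0)) //.
by rewrite ltr_nat.
Qed.

(** * Limit points of the zeros of [hsum] as m grows *)

Lemma hsum_zeros_far (R : realType) (x w : R[i]) :
  `|x| < 1 -> `|w| != 1 -> exists2 r, 0 < r &
  exists N, forall m, (N < m)%N -> forall y, hsum x m y = 0 -> r <= `|y - w|.
Proof.
move=> x1 wn1; have nr (y : R[i]) : `|y| \is Num.real by apply: normr_real.
have [w1|w1|/eqP] := real_ltgtP (nr w) (real1 _); last by rewrite (negbTE wn1).
- pose r := (1 - `|w|) / 2.
  have r0 : 0 < r by rewrite divr_gt0 ?subr_gt0.
  have wr1 : `|w| + r < 1.
    by rewrite -subr_gt0 (_ : _ - _ = r) // /r; field.
  (* This [q] bounds both |x| and all moduli in the disk of radius [r] around [w]. *)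
  pose q := Num.max `|x| (`|w| + r).
  have wrr : `|w| + r \is Num.real by rewrite realD // gtr0_real.
  have cmp : `|x| >=< `|w| + r by apply: real_comparable.
  have q1 : q < 1 by rewrite /q comparable_gt_max // x1.
  have xq : `|x| <= q by rewrite /q comparable_le_max // lexx.
  have wq : `|w| + r <= q by rewrite /q comparable_le_max // lexx orbT.
  have q0 : 0 <= q by apply: le_trans xq.
  exists r => //.
  (* For m >= 1, 3 (m + 1) q^m <= 6 m q^m, so m q^m < 1/6 contradicts [hsum_eq0_inner]. *)
  have [||N Nm] := @complex_natr_mul_expr_small R q (6^-1).
  + by rewrite q0.
  + by rewrite invr_gt0.
  exists N => m mN y Sy; rewrite real_leNgt ?nr ?gtr0_real //; apply/negP => yw.
  have yq : `|y| <= q.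
    apply: le_trans wq; rewrite -[y](subrK w) addrC.
    by apply: le_trans (ler_normD _ _) _; rewrite lerD2l ltW.
  have := hsum_eq0_inner _ x y q m xq yq q1 Sy.
  have mq : m.+1%:R * q ^+ m * 3 <= m%:R * q ^+ m * 6.
    rewrite -subr_ge0 -natr1.
    rewrite (_ : _ - _ = (m%:R - 1) * q ^+ m * 3); last by ring.
    by rewrite !mulr_ge0 ?exprn_ge0 // subr_ge0 ler1n (leq_ltn_trans _ mN).
  move=> /le_trans/(_ mq); have := Nm _ mN.
  rewrite -[X in _ < X]div1r ltr_pdivlMr // => lt1 /le_lt_trans/(_ lt1).
  by rewrite ltxx.
- pose q := (1 + `|w|) / 2; pose r := (`|w| - 1) / 2.
  have r0 : 0 < r by rewrite divr_gt0 ?subr_gt0.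
  have qE : q = `|w| - r by rewrite /q /r; field.
  have q1 : 1 < q by rewrite -subr_gt0 (_ : _ - _ = r) // /q /r; field.
  have q0 : 0 < q by apply: lt_trans q1.
  exists r => //.
  have d0 : 0 < 1 - `|x| by rewrite subr_gt0.
  (* [hsum_eq0_outer] bounds q^-(m+1) below by this constant; the extra factor m + 1 >= 1 is
     dropped. *)
  have [||N Nm] := @complex_natr_mul_expr_small R q^-1 ((1 - `|x|) / 4).
  + by rewrite invr_ge0 ltW //= invf_lt1.
  + by rewrite divr_gt0.
  exists N => m mN y Sy; rewrite real_leNgt ?nr ?gtr0_real //; apply/negP => yw.
  have qy : q <= `|y|.
    rewrite qE lerBlDr -lerBlDl; apply: le_trans (ltW yw).
    by rewrite distrC lerB_dist.
  have := hsum_eq0_outer _ x y q m x1 (ltW q1) qy Sy.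
  rewrite -ler_pdivlMr ?exprn_gt0 // -exprVn.
  have := Nm _ (leqW mN); rewrite ltr_pdivlMr // => lt1.
  rewrite real_leNgt ?gtr0_real // ?mulr_gt0 ?exprn_gt0 ?invr_gt0 // => /negP; apply.
  apply: le_lt_trans lt1; rewrite mulrC.
  have qV0 : 0 <= q^-1 by rewrite invr_ge0 ltW.
  by rewrite ler_wpM2r // ler_peMl ?exprn_ge0 // ler1n.
Qed.

Lemma hsum_zeros_near_neq1 (R : realType) (x w r : R[i]) :
  `|x| < 1 -> `|w| = 1 -> w != 1 -> 0 < r ->
  exists N, forall m, (N < m)%N -> exists2 y, hsum x m y = 0 & `|y - w| < r.
Proof.
move=> x1 w1 wn1 r0.
have d0 : 0 < 1 - `|x| by rewrite subr_gt0.
have rw0 : 0 < `|1 - w| by rewrite normr_gt0 subr_eq0 eq_sym.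
(* The radius is shrunk to meet both upper bounds required by [hsum_root_near]. *)
pose s := Num.min r (Num.min `|1 - w| (1 - `|x|)).
have [rR wR dR] := And3 (gtr0_real r0) (gtr0_real rw0) (gtr0_real d0).
have mR : Num.min `|1 - w| (1 - `|x|) \is Num.real by apply: min_real.
have c1 := real_comparable wR dR; have c2 := real_comparable rR mR.
have s0 : 0 < s by rewrite !comparable_lt_min // r0 rw0.
have : s <= s by [].
rewrite {2}/s !comparable_le_min // => /and3P[sr sw sd].
have [||N1 N1m] := @complex_natr_mul_expr_small R `|x| ((1 - `|x|) / 4).
- by rewrite normr_ge0.
- by rewrite divr_gt0.
have c0 : 0 < s ^+ 2 * ((1 - `|x|) ^+ 2 / 2).
  by rewrite mulr_gt0 ?divr_gt0 ?exprn_gt0.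
have [|N2 N2m] := @complex_natr_large R
  ((36 + 16 * s ^+ 2) / (s ^+ 2 * ((1 - `|x|) ^+ 2 / 2))).
- by rewrite divr_ge0 ?(ltW c0) // addr_ge0 // mulr_ge0 // exprn_ge0 // ltW.
exists (maxn N1 N2) => m; rewrite gtn_max => /andP[mN1 mN2].
have [||y Sy yw] := hsum_root_near _ x w s m x1 w1 s0 sw sd.
- have := N1m _ (leqW (leqW mN1)); rewrite ltr_pdivlMr // => /ltW; apply: le_trans.
  by rewrite mulrC ler_wpM2r // ler_peMl ?exprn_ge0 // ler1n.
- by rewrite -ltr_pdivrMr // N2m // leqW.
by exists y => //; apply: lt_le_trans sr.
Qed.

(** The quotient of 1 + ie by its conjugate has modulus 1 and differs from 1 by 2ie / (1 - ie), of
    modulus at most 2e. *)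
Lemma unit_circle_near1 (R : realType) (r : R[i]) : 0 < r ->
  exists w : R[i], [/\ `|w| = 1, w != 1 & `|w - 1| < r].
Proof.
move=> r0; have [t rE] := complex_realP r (gtr0_real r0).
have t0 : 0 < t by move: r0; rewrite rE -(rmorph0 (real_complex R)) ltcR.
pose e := t / 3; have e0 : 0 < e by rewrite divr_gt0.
pose p : R[i] := 1 +i* e; pose q : R[i] := 1 -i* e.
have q1 : 1 <= `|q|.
  apply: le_trans (normc_ge_Re _); rewrite /= normr1.
  by [].
have q0 : q != 0 by rewrite -normr_gt0 (lt_le_trans _ q1).
have pq : p - q = (2 * e)%:C * 'i.
  by rewrite /p /q; simpc; congr (_ +i* _); lra.
have wE : p / q - 1 = (2 * e)%:C * 'i / q by rewrite -pq mulrBl divff.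
exists (p / q); split.
- rewrite normf_div (_ : p = q^*) ?normcJ ?divff ?normr_eq0 //.
  by rewrite /p /q /= opprK.
- rewrite -subr_eq0 wE !mulf_neq0 ?invr_eq0 //.
    by rewrite eq_complex /= eqxx andbT mulf_neq0 // gt_eqF.
  by rewrite eq_complex /= oner_eq0 andbF.
- rewrite wE normf_div ltr_pdivrMr ?(lt_le_trans _ q1) //.
  apply: (@lt_le_trans _ _ r); last by rewrite ler_peMr // ltW.
  rewrite normrM rE.
  rewrite (_ : `|'i| = 1) ?mulr1; last first.
    by rewrite normc_def /= expr0n expr1n add0r sqrtr1.
  have e2 : 0 <= (2 * e)%:C by rewrite ler0c mulr_ge0 // ltW.
  by rewrite ger0_norm // ltcR /e; lra.
Qed.

(** The point 1 is one of the extra zeros, so it is reached through a nearby point of the circle,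
    with half the radius for each distance. *)
Lemma hsum_zeros_near (R : realType) (x w r : R[i]) :
  `|x| < 1 -> `|w| = 1 -> 0 < r ->
  exists N, forall m, (N < m)%N -> exists2 y, hsum x m y = 0 & `|y - w| < r.
Proof.
move=> x1 w1 r0; have [->|wn1] := eqVneq w 1; last exact: hsum_zeros_near_neq1.
have r20 : 0 < r / 2 by rewrite divr_gt0.
have [v [v1 vn1 vr]] := unit_circle_near1 _ _ r20.
have [N Nm] := hsum_zeros_near_neq1 _ _ _ _ x1 v1 vn1 r20.
exists N => m /Nm[y Sy yv]; exists y => //.
rewrite -[y](subrK v) -addrA [r]splitr.
exact: le_lt_trans (ler_normD _ _) (ltrD yv vr).
Qed.

(** * From the Taylor coefficients to [hsum] *)

(** The quadratic is c (1 - u t)(1 - v t), and this is its partial fraction expansion multiplied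
    out. The recursion has order two, hence the induction on consecutive pairs. *)
Lemma recip_coef_geometric (R : realType) (u v c : R) n : c != 0 ->
  (u - v) * c * recip_coef (c * u * v) (- (c * (u + v))) c n =
  u ^+ n.+1 - v ^+ n.+1.
Proof.
move=> c0; set d := recip_coef _ _ _.
suff [] : (u - v) * c * d n = u ^+ n.+1 - v ^+ n.+1 /\
  (u - v) * c * d n.+1 = u ^+ n.+2 - v ^+ n.+2 by [].
elim: n => [|n [IH1 IH2]]; first by split; rewrite /d /=; field.
split=> //.
rewrite (_ : d n.+2 = (u + v) * d n.+1 - u * v * d n); last by rewrite /d /=; field.
rewrite mulrBr !(mulrCA ((u - v) * c)) IH1 IH2 ![_ ^+ n.+3]exprS ![_ ^+ n.+2]exprS.
by ring.
Qed.

Lemma Pgen_hsum (R : realType) (u v c : R) m (w : R[i]) : c != 0 -> u != 0 ->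
  ((u - v) * c)%:C * Pgen (c * u * v) (- (c * (u + v))) c m (u%:C * w) =
  (u ^+ m.+1)%:C * hsum (v / u)%:C m w.
Proof.
move=> c0 u0; rewrite /Pgen /hsum !mulr_sumr; apply: eq_bigr => k _.
rewrite mulrA -rmorphM recip_coef_geometric // exprMn mulrA [in RHS]mulrA.
congr (_ * _); rewrite -!rmorphXn -(rmorph1 (real_complex R)) -rmorphB -!rmorphM.
congr (_%:C); rewrite expr_div_n.
have km : (k <= m)%N by rewrite -ltnS.
have -> : u ^+ m.+1 = u ^+ (m - k).+1 * u ^+ k by rewrite -exprD addSn subnK.
by field; rewrite expf_neq0.
Qed.

(** The dilation by [u] maps the zeros of [hsum] at [v / u] onto those of [f] and scales all
    distances by |u|. *)
Lemma Pgen_zeros (R : realType) (c u v : R) : c != 0 -> `|v| < `|u| ->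
  let f := Pgen (c * u * v) (- (c * (u + v))) c in
  (forall z : R[i], `|z| = `|u%:C| -> liminf_zeros f z) /\
  (forall z : R[i], limsup_zeros f z -> `|z| = `|u%:C|).
Proof.
move=> c0 vu f.
have u0 : u != 0 by rewrite -normr_gt0 (le_lt_trans _ vu).
have uC0 : u%:C != 0 by rewrite (inj_eq (@complexI R)).
have uv : (u - v) * c != 0.
  by rewrite mulf_neq0 // subr_eq0; apply: contraTneq vu => ->; rewrite ltxx.
have x1 : `|(v / u)%:C| < 1.
  rewrite normc_def /= expr0n addr0 sqrtr_sqr normf_div.
  by rewrite -(rmorph1 (real_complex R)) ltcR ltr_pdivrMr ?normr_gt0 // mul1r.
have f0 m w : f m (u%:C * w) = 0 <-> hsum (v / u)%:C m w = 0.
  have E := Pgen_hsum R u v c m w c0 u0; split=> H.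
    move/eqP: E; rewrite -/f H mulr0 eq_sym mulf_eq0 (inj_eq (@complexI R)).
    by rewrite expf_eq0 (negbTE u0) andbF /= => /eqP.
  move/eqP: E; rewrite -/f H mulr0 mulf_eq0 (inj_eq (@complexI R)).
  by rewrite (negbTE uv) /= => /eqP.
have uu z : u%:C * (z / u%:C) = z by rewrite mulrC divfK.
have dist y z : `|u%:C * y - z| = `|u%:C| * `|y - z / u%:C|.
  by rewrite -[in LHS](uu z) -mulrBr normrM.
have uN : 0 < `|u%:C| by rewrite normr_gt0.
split=> z.
- move=> zu r r0.
  have w1 : `|z / u%:C| = 1 by rewrite normf_div zu divff ?gt_eqF.
  have r1 : 0 < r%:C / `|u%:C|.
    by rewrite divr_gt0 // -(rmorph0 (real_complex R)) ltcR.
  have [N Nm] := hsum_zeros_near _ _ _ _ x1 w1 r1.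
  exists N => m /Nm[y Sy yz]; exists (u%:C * y); split; first exact/f0.
  by rewrite dist mulrC -ltr_pdivlMr.
- move=> zlim; apply/eqP; apply/negP => /negP zu.
  have w1 : `|z / u%:C| != 1.
    rewrite normf_div; apply: contra zu => /eqP E.
    by rewrite -[eqbLHS](divfK (lt0r_neq0 uN)) E mul1r.
  have [r r0 [N Nm]] := hsum_zeros_far _ _ _ x1 w1.
  have ru0 : 0 < `|u%:C| * r by rewrite mulr_gt0.
  have [t tE] := complex_realP _ (gtr0_real ru0).
  have t0 : 0 < t by move: ru0; rewrite tE -(rmorph0 (real_complex R)) ltcR.
  have [m [mN [y [fy]]]] := zlim t t0 N.
  rewrite -[y]uu in fy *; rewrite dist -tE ltr_pM2l // => yz.
  have /(Nm _ mN) := (f0 m (y / u%:C)).1 fy.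
  by move=> /(lt_le_trans yz); rewrite ltxx.
Qed.

(** * The two real roots and their reciprocals *)

Theorem theorem3 (R : realType) (a b c : R) (alpha : R[i]) :
  a != 0 -> b != 0 -> c != 0 -> 0 < b ^+ 2 - 4%:R * a * c ->
  a%:C * alpha ^+ 2 + b%:C * alpha + c%:C = 0 ->
  (forall beta : R[i], a%:C * beta ^+ 2 + b%:C * beta + c%:C = 0 ->
     `|alpha| <= `|beta|) ->
  (forall z : R[i], liminf_zeros (Pgen a b c) z <-> limsup_zeros (Pgen a b c) z) /\
  (forall z : R[i], liminf_zeros (Pgen a b c) z <-> `|z| = `|alpha|^-1).
Proof.
move=> a0 b0 c0 disc0 root_alpha alpha_min.
(* The root is real: (2 a alpha + b)^2 is the discriminant, the square of the real [s]. *)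
have [A alphaE] : exists A : R, alpha = A%:C.
  set s := Num.sqrt (b ^+ 2 - 4%:R * a * c).
  have : ((2 * a)%:C * alpha + b%:C) ^+ 2 == s%:C ^+ 2.
    rewrite -rmorphXn sqr_sqrtr ?ltW // -subr_eq0; apply/eqP.
    transitivity ((4 * a)%:C * (a%:C * alpha ^+ 2 + b%:C * alpha + c%:C)).
      by rewrite !(rmorphM, rmorphB, rmorphXn, rmorph_nat); ring.
    by rewrite root_alpha mulr0.
  have a20 : (2 * a)%:C != 0.
    by rewrite (inj_eq (@complexI R)) mulf_neq0 // pnatr_eq0.
  rewrite eqf_sqr => /orP[]/eqP E.
    exists ((s - b) / (2 * a)).
    by rewrite rmorphM fmorphV rmorphB /= -E addrK mulrC mulKf.
  exists ((- s - b) / (2 * a)).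
  by rewrite rmorphM fmorphV rmorphB rmorphN /= -E addrK mulrC mulKf.
have rootA : a * A ^+ 2 + b * A + c = 0.
  apply: (@complexI R); rewrite !rmorphD rmorphM rmorphXn rmorphM rmorph0 /= -alphaE.
  exact: root_alpha.
(* The other root, from the sum of the roots. *)
pose B := - b / a - A.
have rootB : a * B ^+ 2 + b * B + c = 0.
  by rewrite -rootA /B; field.
have normC (y : R) : `|y%:C| = `|y|%:C by rewrite normc_def /= expr0n addr0 sqrtr_sqr.
have leAB : `|A| <= `|B|.
  rewrite -lecR -!normC -alphaE; apply: alpha_min.
  by rewrite -rmorphXn -!rmorphM -!rmorphD rootB.
have bE : b = - (a * (A + B)) by rewrite /B; field.
have cE : c = a * A * B.
  by apply/eqP; rewrite eq_sym -subr_eq0 -oppr0 -rootA; apply/eqP; rewrite /B; field.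
clearbody B.
have [A0 B0] : A != 0 /\ B != 0.
  by move: c0; rewrite cE !mulf_eq0 !negb_or => /andP[/andP[]].
(* Equal moduli would force A = B, with zero discriminant, or A = -B, with b = 0. *)
have ltAB : `|A| < `|B|.
  rewrite lt_neqAle leAB andbT eqr_norm2.
  apply/negP => /orP[]/eqP E.
    by move: disc0; rewrite bE cE E (_ : _ - _ = 0) ?ltxx //; ring.
  by move: b0; rewrite bE E addNr mulr0 oppr0 eqxx.
have aE : a = c * A^-1 * B^-1 by rewrite cE; field; rewrite ?A0 ?B0.
have bE' : b = - (c * (A^-1 + B^-1)) by rewrite cE bE; field; rewrite ?A0 ?B0.
have ltV : `|B^-1| < `|A^-1|.
  by rewrite !normfV ltf_pV2 ?posrE ?normr_gt0.
have [] := Pgen_zeros R c A^-1 B^-1 c0 ltV.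
rewrite -aE -bE' alphaE -normfV -fmorphV => lower upper.
have inf_sup z : liminf_zeros (Pgen a b c) z -> limsup_zeros (Pgen a b c) z.
  move=> zinf r r0 N; have [M Mm] := zinf r r0.
  exists (maxn N M).+1; rewrite ltnS leq_maxl; split=> //.
  by apply: Mm; rewrite ltnS leq_maxr.
split=> z; split; [exact: inf_sup | by move/upper/lower
  | by move/inf_sup/upper | exact: lower].
Qed.
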